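(* Let $q\in[1,\infty]$. The problem of computing the expectation $\mathbb E Y$ via i.i.d.-based algorithms is not solvable on the class $\mathcal Y_q=L_q$ of all $q$-integrable random variables.
   Context: Random variables are real-valued on a probability space $(\Omega,\Sigma,\mathbb P)$, assumed rich enough to carry all random variables considered (random variables with arbitrary distributions, sequences of i.i.d. copies, independent auxiliary randomness). For $q=\infty$, $L_\infty$ is the class of essentially bounded random variables. An i.i.d.-based algorithm on a class $\mathcal Y$ of random variables consists of: an auxiliary random variable $U$ with values in a measurable space $(\mathbb U,\Sigma_U)$; a measurable $\phi:\mathbb U\times\mathbb R^{\mathbb N}\to\mathbb R$; and a measurable stopping rule $n:\mathbb U\times\mathbb R^{\mathbb N}\to\mathbb N_0\cup\{\infty\}$ such that whether $n(u,(y_j)_j)\ge i$ depends only on $(u,y_1,\dots,y_{i-1})$. For $Y\in\mathcal Y$ with i.i.d. copies $(Y_i)_{i\in\mathbb N}$, independent of $U$, put $n(\omega,Y):=n(U(\omega),(Y_i(\omega))_i)$, assumed almost surely finite for each $Y\in\mathcal Y$, and $A(\omega,Y):=\phi(U(\omega),Y_1(\omega),\dots,Y_{n(\omega,Y)}(\omega),0,0,\dots)$; $A(Y):=A(\cdot,Y)$. The problem is solvable on $\mathcal Y$ if for all $\varepsilon>0$ and $\delta\in(0,1)$ there is an i.i.d.-based algorithm $A$ on $\mathcal Y$ such that $\mathbb P\{|A(Y)-\mathbb E Y|\le\varepsilon\}\ge1-\delta$ for all $Y\in\mathcal Y$. *)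

(* Defs.v *)
From HB Require Import structures.
From mathcomp Require Import all_boot all_order all_algebra finmap.
From mathcomp Require Import all_classical all_reals all_analysis.

Set Implicit Arguments.
Unset Strict Implicit.
Unset Printing Implicit Defensive.

Import Order.TTheory GRing.Theory Num.Theory.
Import numFieldNormedType.Exports.

Local Open Scope classical_set_scope.
Local Open Scope ring_scope.

(* R^N with the product sigma-algebra.  Sequences are indexed from 0, so that
   y_1, y_2, ... is y 0, y 1, ... *)
Definition coordinate_preimages (R : realType) : set (set (nat -> R)) :=
  [set C | exists (i : nat) (B : set R),
      measurable B /\ C = [set y | B (y i)]].

Definition real_seq (R : realType) : Type :=
  g_sigma_algebraType (@coordinate_preimages R).

HB.instance Definition _ (R : realType) := Measurable.on (real_seq R).

(* N_0 together with infinity is [option nat], where [None] is infinity. *)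
Definition at_least (n : option nat) (i : nat) : bool :=
  if n is Some k then (i <= k)%N else true.

(* (y_1, ..., y_n, 0, 0, ...); the value for n = infinity is immaterial since
   stopping rules are required to be almost surely finite. *)
Definition truncate (R : realType) (n : option nat) (y : real_seq R) :
    real_seq R :=
  fun j => if at_least n j.+1 then y j else 0.

(* The auxiliary random variable U enters through its value space and its law;
   it is realized together with the i.i.d. copies in [iid_input] below. *)
Record iid_algorithm (R : realType) := IidAlgorithm {
  aux_display : measure_display;
  aux : measurableType aux_display;
  aux_law : probability aux R;
  estimator : aux * real_seq R -> R;
  measurable_estimator : measurable_fun [set: aux * real_seq R] estimator;
  stopping : aux * real_seq R -> option nat;
  (* measurability for the discrete sigma-algebra on [option nat] *)
  measurable_stopping :
    forall S : set (option nat), measurable (stopping @^-1` S);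
  (* with 0-based indices, y_1, ..., y_{i-1} are the y j with j + 1 < i *)
  stopping_nonanticipative :
    forall (i : nat) (u : aux) (y y' : real_seq R),
      (forall j : nat, (j.+1 < i)%N -> y j = y' j) ->
      at_least (stopping (u, y)) i = at_least (stopping (u, y')) i
}.

Section realization.
Context (R : realType) (d : measure_display) (Omega : measurableType d).
Variable P : probability Omega R.

Definition mutually_independent (X : nat -> {RV P >-> R}) : Prop :=
  forall (I : {fset nat}) (B : nat -> set R),
    (forall i, measurable (B i)) ->
    P (\bigcap_(i in [set` I]) (X i @^-1` B i)) =
    (\prod_(i <- I) P (X i @^-1` B i))%E.

Definition sample (X : nat -> {RV P >-> R}) (w : Omega) : real_seq R :=
  fun i => X i w.

Definition independent_of (d' : measure_display) (T : measurableType d')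
    (U : {RV P >-> T}) (X : nat -> {RV P >-> R}) : Prop :=
  forall (B : set T) (C : set (real_seq R)),
    measurable B -> measurable C ->
    P (U @^-1` B `&` sample X @^-1` C) =
    (P (U @^-1` B) * P (sample X @^-1` C))%E.

Definition iid_copies (Y : {RV P >-> R}) (X : nat -> {RV P >-> R}) : Prop :=
  (forall (i : nat) (B : set R), measurable B ->
     distribution P (X i) B = distribution P Y B) /\
  mutually_independent X.

Definition iid_input (A : iid_algorithm R) (U : {RV P >-> aux A})
    (Y : {RV P >-> R}) (X : nat -> {RV P >-> R}) : Prop :=
  [/\ forall B : set (aux A), measurable B ->
        distribution P U B = aux_law A B,
      iid_copies Y X
    & independent_of U X].

Definition sample_size (A : iid_algorithm R) (U : {RV P >-> aux A})
    (X : nat -> {RV P >-> R}) (w : Omega) : option nat :=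
  stopping (U w, sample X w).

Definition output (A : iid_algorithm R) (U : {RV P >-> aux A})
    (X : nat -> {RV P >-> R}) (w : Omega) : R :=
  estimator (U w, truncate (sample_size U X w) (sample X w)).

End realization.

(* A single sufficiently rich probability space is replaced by all probability
   spaces: a class of random variables is a property of random variables on
   arbitrary probability spaces, and requirements on U, Y and the copies of Y
   are imposed on every probability space carrying them. *)
Definition rv_class (R : realType) : Type :=
  forall (d : measure_display) (Omega : measurableType d)
    (P : probability Omega R), set (Omega -> R).

Definition algorithm_on (R : realType) (C : rv_class R) (A : iid_algorithm R) :
    Prop :=
  forall (d : measure_display) (Omega : measurableType d)
    (P : probability Omega R) (U : {RV P >-> aux A}) (Y : {RV P >-> R})
    (X : nat -> {RV P >-> R}),
    C d Omega P Y -> iid_input U Y X ->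
    {ae P, forall w, sample_size U X w <> None}.

Definition solvable (R : realType) (C : rv_class R) : Prop :=
  forall eps delta : R, 0 < eps -> 0 < delta < 1 ->
  exists A : iid_algorithm R,
    algorithm_on C A /\
    forall (d : measure_display) (Omega : measurableType d)
      (P : probability Omega R) (U : {RV P >-> aux A}) (Y : {RV P >-> R})
      (X : nat -> {RV P >-> R}),
      C d Omega P Y -> iid_input U Y X ->
      ((1 - delta)%:E <=
       P [set w | `| (output U X w)%:E - 'E_P[Y] | <= eps%:E])%E.

Definition Lq_class (R : realType) (q : \bar R) : rv_class R :=
  fun d Omega P => [set Y | Y \in Lfun P q].

(* Main.v *)
Require Import Defs.
From HB Require Import structures.
From mathcomp Require Import all_boot all_order all_algebra finmap.
From mathcomp Require Import all_classical all_reals all_analysis.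
From mathcomp Require Import measurable_realfun lra.

Set Implicit Arguments.
Unset Strict Implicit.
Unset Printing Implicit Defensive.

Import Order.TTheory GRing.Theory Num.Theory.
Import numFieldNormedType.Exports.

Local Open Scope classical_set_scope.
Local Open Scope ring_scope.

(** Run the algorithm on the constant random variable 0: with probability more
    than 1/2 it stops after at most N samples and outputs a value of modulus at
    most 1.  Now feed it a random variable equal to 3/p with probability p and
    to 0 otherwise, where p = 1/(4(N+1)).  With probability at least 3/4 the
    first N samples all vanish, and then the algorithm behaves as on the input
    0, whereas the expectation is 3.  So the error exceeds 1 with probability at
    least 3/8, which contradicts solvability with eps = 1 and delta = 1/4.

    The i.i.d. coin tosses are realized on [0,1[ with Lebesgue measure as
    [t |-> K * 1_(t < p)] along the orbits of the piecewise affine map that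
    stretches both [0,p[ and [p,1[ onto [0,1[. *)

Lemma measurable_preimage d d' (T : measurableType d) (T' : measurableType d')
    (h : T -> T') (C : set T') :
  measurable_fun setT h -> measurable C -> measurable (h @^-1` C).
Proof. by move=> mh mC; rewrite -[_ @^-1` _]setTI; exact: mh. Qed.

(** * Independence along the orbits of a map *)

Section iterates.
Context d (T : measurableType d) (R : realType) (mu : probability T R).
Variables (f : T -> R) (g : T -> T).
Hypothesis mf : measurable_fun setT f.
Hypothesis mg : measurable_fun setT g.
(** Two facts in one identity: [B = setT] says that [g] preserves [mu], and general [B] then says
    that [f] and [g] are independent. *)
Hypothesis fg : forall (B : set R) (C : set T), measurable B -> measurable C ->
  mu (f @^-1` B `&` g @^-1` C) = (mu (f @^-1` B) * mu C)%E.

Lemma measurable_iterate n : measurable_fun setT (f \o iter n g).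
Proof.
apply: measurableT_comp => //.
by elim: n => [|n IHn]; [exact: measurable_id|exact: measurableT_comp mg IHn].
Qed.

Lemma iterate_law n (B : set R) : measurable B ->
  mu ((f \o iter n g) @^-1` B) = mu (f @^-1` B).
Proof.
move=> mB; elim: n => [//|n IHn].
have := fg measurableT (measurable_preimage (measurable_iterate n) mB).
rewrite preimage_setT setTI probability_setT mul1e IHn => <-.
by congr (mu _); apply/seteqP; split => t /=; rewrite -iterSr.
Qed.

(* Peeling off the factor i = 0 leaves the preimage under g of a set of the
   same form. *)
Lemma iterate_independent_seg n (B : nat -> set R) :
  (forall i, measurable (B i)) ->
  mu (\bigcap_(i in `I_n) (f \o iter i g) @^-1` B i) =
  (\prod_(i < n) mu (f @^-1` B i))%E.
Proof.
elim: n B => [|n IHn] B mB.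
  by rewrite II0 bigcap_set0 big_ord0 probability_setT.
rewrite big_ord_recl -(IHn (fun i => B i.+1))// -fg//; last first.
  apply: bigcap_measurableType => i _.
  exact: measurable_preimage (measurable_iterate i) (mB _).
congr (mu _); apply/seteqP; split => t /=.
- move=> Bt; split; first exact: (Bt 0).
  by move=> i ltin; have := Bt i.+1 ltin; rewrite /= -iterSr.
- by case=> Bt0 Bt [//|i] ltin; rewrite /= -/(iter i.+1 g t) iterSr; exact: Bt.
Qed.

(** A finite index set is padded to an initial segment, with [setT] at the missing indices; these
    contribute the factor 1. *)
Lemma iterate_independent (I : {fset nat}) (B : nat -> set R) :
  (forall i, measurable (B i)) ->
  mu (\bigcap_(i in [set` I]) (f \o iter i g) @^-1` B i) =
  (\prod_(i <- I) mu ((f \o iter i g) @^-1` B i))%E.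
Proof.
move=> mB; pose B' i := if i \in I then B i else setT.
have mB' i : measurable (B' i) by rewrite /B'; case: ifP.
pose n := (\max_(i <- I) i).+1.
have ltIn i : i \in I -> (i < n)%N.
  by move=> iI; rewrite ltnS; exact: leq_bigmax_seq.
have -> : \bigcap_(i in [set` I]) (f \o iter i g) @^-1` B i =
    \bigcap_(i in `I_n) (f \o iter i g) @^-1` B' i.
  apply/seteqP; split => t /= Bt i; rewrite /=.
  - by move=> _; rewrite /B'; case: ifP => // iI; exact: Bt.
  - by move=> iI; have := Bt i (ltIn i iI); rewrite /= /B' iI.
rewrite iterate_independent_seg//.
under [RHS]eq_bigr do rewrite iterate_law//.
have pI : perm_eq I [seq i <- index_iota 0 n | i \in I].
  apply: uniq_perm; rewrite ?fset_uniq ?filter_uniq ?iota_uniq// => i.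
  rewrite mem_filter mem_index_iota/=.
  by case: (boolP (i \in I)) => // /ltIn ->.
rewrite (perm_big _ pI) big_filter [RHS]big_mkcond big_mkord.
apply: eq_bigr => i _; rewrite /B'; case: ifP => //.
by rewrite preimage_setT probability_setT.
Qed.
End iterates.

(** * Uniform law on [0, 1[ and the expanding map *)

Section uniform.
Context (R : realType).

Definition unif01 : set (measurableTypeR R) -> \bar R :=
  mrestr lebesgue_measure (measurable_itv `[0%R : R, 1%R[).

HB.instance Definition _ := Measure.on unif01.

Lemma unif01_itv (a b : R) (A : set (measurableTypeR R)) :
  a <= b -> A `&` `[0, 1[ = `[a, b[%classic -> unif01 A = (b - a)%:E.
Proof.
move=> ab Aab; rewrite /unif01 /mrestr Aab lebesgue_measure_itv/= lte_fin.
move: ab; rewrite le_eqVlt => /predU1P[->|->]; last by rewrite EFinB.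
by rewrite ltxx subrr.
Qed.

Lemma unif01_setT : unif01 setT = 1%:E.
Proof. by rewrite (@unif01_itv 0 1) ?setTI// subr0. Qed.

HB.instance Definition _ :=
  @Measure_isProbability.Build _ _ R unif01 unif01_setT.

Variable p : R.

Definition expanding (t : measurableTypeR R) : measurableTypeR R :=
  if t < p then p^-1 * t else (1 - p)^-1 * (t - p).

Lemma measurable_expanding : measurable_fun setT expanding.
Proof.
suff : measurable_fun setT (expanding : measurableTypeR R -> R) by [].
apply: measurable_fun_ifT => //=.
- exact: measurable_fun_ltr.
- by apply: measurable_funM => //; exact: measurable_funB.
Qed.

(** The distribution function of the uniform law. *)
Definition clamp (x : R) : R := Num.max 0 (Num.min x 1).

Lemma clampE x : [/\ x <= 0 & clamp x = 0] \/ [/\ 0 <= x <= 1 & clamp x = x] \/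
  [/\ 1 <= x & clamp x = 1].
Proof.
rewrite /clamp; case: (leP x 1) => x1; last first.
  by right; right; rewrite max_r// ltW.
case: (leP 0 x) => x0; first by right; left.
by left; rewrite ltW.
Qed.

Lemma unif01_ray x : unif01 `]-oo, x[ = (clamp x)%:E.
Proof.
have h := clampE x.
rewrite (@unif01_itv 0 (clamp x)) ?subr0//; first by lra.
apply/seteqP; split=> t /=; rewrite !in_itv/=.
  by case=> [? /andP[? ?]]; lra.
by move=> /andP[? ?]; split; lra.
Qed.

(** Finite measures that agree on the rays []-oo, x[], a generating pi-system, agree on all Borel
    sets. Here [m1] is the image under [expanding] of the restriction to [S], and [m2] is [s] times
    the uniform law. *)
Lemma unif01_split (S : set (measurableTypeR R)) (s : {nonneg R})
    (mS : measurable S) :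
  (forall x,
    unif01 (S `&` expanding @^-1` `]-oo, x[) = (s%:num * clamp x)%:E) ->
  forall C, measurable C ->
  unif01 (S `&` expanding @^-1` C) = (s%:num%:E * unif01 C)%E.
Proof.
move=> Sray C mC.
rewrite setIC.
pose m1 : {measure set (measurableTypeR R) -> \bar R} :=
  measure_function_pushforward__canonical__measure_function_Measure
    (mrestr unif01 mS) measurable_expanding.
pose m2 := mscale s unif01.
rewrite -[LHS]/(m1 C) -[RHS]/(m2 C).
apply: (@measure_unique _ R (measurableTypeR R) (@RGenInftyO.G R)
  (fun k => `]-oo, k%:R[%classic)) => //.
- exact: RGenInftyO.measurableE.
- move=> _ _ [x ->] [y ->]; exists (Num.min x y).
  apply/seteqP; split => t /=; rewrite !in_itv/= lt_min; last by move/andP.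
  by move=> [-> ->].
- by move=> k; exists k%:R.
- apply/seteqP; split => // t _; exists (Num.truncn `|t|).+1 => //=.
  by rewrite in_itv/= (le_lt_trans (ler_norm _))// truncnS_gt.
- move=> _ [x ->].
  rewrite /m2 /mscale /m1/= /pushforward /mrestr /= setIC Sray.
  by rewrite EFinM -unif01_ray.
- by move=> k; rewrite /m1/= /pushforward /mrestr /= setIC Sray ltry.
Qed.

Definition low : set (measurableTypeR R) := [set t : R | t < p].

Lemma measurable_low : measurable low.
Proof. by rewrite /low -set_itvNyo; exact: measurable_itv. Qed.

Lemma unif01_low : 0 < p < 1 -> unif01 low = p%:E.
Proof.
move=> p01; have p0 : 0 <= p by lra.
rewrite (@unif01_itv 0 p) ?subr0//.
apply/seteqP; split=> t; rewrite /low /= !in_itv/=.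
  by move=> [? /andP[? ?]]; lra.
by move=> /andP[? ?]; split; lra.
Qed.

(** The lower branch has slope [p^-1], so inside [0, 1[ it pulls a ray of mass [c] back to [0, p
    c[. *)
Lemma unif01_lowI C : 0 < p < 1 -> measurable C ->
  unif01 (low `&` expanding @^-1` C) = (unif01 low * unif01 C)%E.
Proof.
move=> p01; have p0 : 0 <= p by lra.
rewrite unif01_low//; apply: (@unif01_split _ (NngNum p0)) => //=.
  exact: measurable_low.
move=> x; have := clampE x; set c := clamp x => h.
have pc : 0 <= p * c by nra.
rewrite (@unif01_itv 0 (p * c)) ?subr0//.
apply/seteqP; split=> t; rewrite /low /= !in_itv/= /expanding.
- move=> [[tp]]; rewrite tp ltr_pdivrMl//; last by lra.
  by move=> ? /andP[? ?]; nra.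
- move=> /andP[t0 tp]; have tp' : t < p by nra.
  by rewrite tp' ltr_pdivrMl//; [split; [split|]; nra | lra].
Qed.

(** The upper branch has slope [(1 - p)^-1] and pulls a ray of mass [c] back to [p, p + (1 - p)
    c[. *)
Lemma unif01_lowCI C : 0 < p < 1 -> measurable C ->
  unif01 (~` low `&` expanding @^-1` C) = (unif01 (~` low) * unif01 C)%E.
Proof.
move=> p01; have p0 : 0 <= 1 - p by lra.
have lowC : ~` low = [set t : R | p <= t].
  by apply/seteqP; split => t; rewrite /low/= leNgt => /negP.
have -> : unif01 (~` low) = (1 - p)%:E.
  by rewrite probability_setC ?EFinB -?unif01_low//; exact: measurable_low.
apply: (@unif01_split _ (NngNum p0)) => //=.
  by apply: measurableC; exact: measurable_low.
move=> x; have := clampE x; set c := clamp x => h.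
have pc : p <= p + (1 - p) * c by nra.
rewrite lowC (@unif01_itv p (p + (1 - p) * c))//; first by congr EFin; lra.
apply/seteqP; split=> t; rewrite /= !in_itv/= /expanding.
- move=> [[tp]]; rewrite (ltNge _ p) tp/= ltr_pdivrMl//; last by lra.
  by move=> ? /andP[? ?]; nra.
- move=> /andP[tp t1].
  by rewrite (ltNge _ p) tp/= ltr_pdivrMl//; [split; [split|]; nra | lra].
Qed.
End uniform.

Lemma measurable_real_seq (R : realType) d (T : measurableType d)
    (h : T -> real_seq R) :
  (forall i, measurable_fun setT (fun t => h t i)) -> measurable_fun setT h.
Proof.
move=> mh.
have := @measurability _ _ T (real_seq R) setT h (@coordinate_preimages R).
apply => //.
move=> _ [_ [i [B [mB ->]]] <-]; exact: (mh i measurableT B mB).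
Qed.

(** * Coin tosses independent of the auxiliary variable *)

Section coin.
Context (R : realType) (K p : R).
Hypothesis p01 : 0 < p < 1.

Definition coin : measurableTypeR R -> R := K \o* \1_(low p).

Lemma measurable_coin : measurable_fun setT coin.
Proof.
apply: measurable_funM => //; apply: measurable_indic.
exact: measurable_low.
Qed.

(** Only whether [B] contains 0 and [K] matters: its preimage is the whole space, [low p], the
    complement of [low p], or empty. The two branches settle the middle cases, and their sum settles
    the first. *)
Lemma unif01_coinI (B : set R) (C : set (measurableTypeR R)) :
  measurable B -> measurable C ->
  unif01 (coin @^-1` B `&` expanding p @^-1` C) =
  (unif01 (coin @^-1` B) * unif01 C)%E.
Proof.
move=> mB mC.
have mgC : measurable (expanding p @^-1` C).
  by apply: measurable_preimage => //; exact: measurable_expanding.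
have mL := measurable_low p.
rewrite /coin [X in unif01 (X `&` _)](_ : _ =
    (\1_(low p) : _ -> R) @^-1` ((fun x => x * K) @^-1` B))//.
rewrite [X in (unif01 X * _)%E](_ : _ =
    (\1_(low p) : _ -> R) @^-1` ((fun x => x * K) @^-1` B))//.
rewrite preimage_indic; case: ifP => _; case: ifP => _.
- rewrite setTI probability_setT mul1e.
  have split_low (X : set (measurableTypeR R)) : measurable X ->
      unif01 X = (unif01 (low p `&` X) + unif01 (~` low p `&` X))%E.
    move=> mX; rewrite -[in LHS](setTI X) -(setvU (low p)) setIUl setUC.
    rewrite measureU//.
    + exact: measurableI.
    + by apply: measurableI => //; exact: measurableC.
    + by rewrite setIACA setICr set0I.
  rewrite split_low// unif01_lowI// unif01_lowCI// -ge0_muleDl//.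
  have := split_low setT measurableT.
  by rewrite !setIT unif01_setT => <-; rewrite mul1e.
- exact: unif01_lowI.
- exact: unif01_lowCI.
- by rewrite set0I measure0 mul0e.
Qed.

End coin.

(** On the product of [aux A] with the line, [U] is the first projection and the tosses read the
    second coordinate, so they are independent of [U]. The last clause serves the case [K = 0],
    where it makes every sample vanish surely. *)
Lemma coin_realization (R : realType) (A : iid_algorithm R) (K p : R) :
  0 < p < 1 ->
  exists (d : measure_display) (Omega : measurableType d)
    (P : probability Omega R) (U : {RV P >-> aux A}) (Y : {RV P >-> R})
    (X : nat -> {RV P >-> R}) (S : set Omega),
    [/\ iid_input U Y X, measurable S, P S = p%:E,
        Y = (K \o* \1_S) :> (Omega -> R) &
        forall i w, X i w = 0 \/ X i w = K].
Proof.
move=> p01.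
pose P : probability (aux A * measurableTypeR R)%type R :=
  (aux_law A \x @unif01 R)%E.
have PX B C : measurable B -> measurable C ->
    P (fst @^-1` B `&` snd @^-1` C) = (aux_law A B * unif01 C)%E.
  by move=> mB mC; rewrite -product_measure1E.
have Psnd C : measurable C -> P (snd @^-1` C) = unif01 C.
  move=> mC; have := PX _ _ measurableT mC.
  by rewrite preimage_setT setTI probability_setT mul1e.
have Pfst B : measurable B -> P (fst @^-1` B) = aux_law A B.
  move=> mB; have := PX _ _ mB measurableT.
  by rewrite preimage_setT setIT probability_setT mule1.
pose x i := coin K p \o iter i (expanding p).
have mf := measurable_coin K p; have mg := measurable_expanding p.
have fg := unif01_coinI K p01.
have mx i : measurable_fun setT (x i) by exact: measurable_iterate.
have mX i : measurable_fun setT (x i \o snd : aux A * measurableTypeR R -> R).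
  exact: measurableT_comp.
have mU : measurable_fun setT (fst : aux A * measurableTypeR R -> aux A) by [].
pose U : {RV P >-> aux A} := mfun_Sub (mem_set mU).
pose X i : {RV P >-> R} := mfun_Sub (mem_set (mX i)).
(* [X 0] itself can serve as [Y], since [iid_copies] constrains only the law of [Y]. *)
exists _, _, P, U, (X 0%N), X, (snd @^-1` low p); split.
- split.
  + by move=> B mB; rewrite -Pfst.
  + split=> [i B mB|I B mB].
    * rewrite /distribution /pushforward.
      rewrite -[LHS]/(P (snd @^-1` (x i @^-1` B))).
      rewrite -[RHS]/(P (snd @^-1` (x 0%N @^-1` B))).
      rewrite !Psnd; try exact: measurable_preimage.
      by rewrite !(iterate_law mf mg fg).
    * rewrite -[LHS]/(P (snd @^-1` (\bigcap_(i in [set` I]) x i @^-1` B i))).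
      rewrite Psnd; last first.
        by apply: bigcap_measurableType => i _; exact: measurable_preimage.
      rewrite (iterate_independent mf mg fg)//; apply: eq_bigr => i _.
      rewrite -[RHS]/(P (snd @^-1` (x i @^-1` B i))) Psnd//.
      exact: measurable_preimage.
  + move=> B C mB mC.
    pose h t : real_seq R := fun i => x i t.
    have mh : measurable_fun setT h by exact: measurable_real_seq.
    have mhC : measurable (h @^-1` C) by exact: measurable_preimage.
    rewrite -[LHS]/(P (fst @^-1` B `&` snd @^-1` (h @^-1` C))).
    rewrite -[RHS]/(P (fst @^-1` B) * P (snd @^-1` (h @^-1` C)))%E.
    by rewrite PX// Pfst// Psnd.
- by apply: measurable_preimage => //; exact: measurable_low.
- by rewrite Psnd ?unif01_low//; exact: measurable_low.
- by [].
- move=> i w; rewrite /X/= /x/= /coin/= indicE.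
  by case: (_ \in _); [right; rewrite mul1r|left; rewrite mul0r].
Qed.

(** Under a probability, an essentially bounded function lies in every L_q; this treats finite [q]
    and [+oo] at once. *)
Lemma Lfun_bounded d (T : measurableType d) (R : realType)
    (P : probability T R) (f : T -> R) (q : \bar R) (M : R) :
  (1 <= q)%E -> measurable_fun setT f -> (forall t, `|f t| <= M) ->
  f \in Lfun P q.
Proof.
move=> q1 mf fM; apply: (@Lfun_subset _ _ _ P q +oo%E) => //; rewrite ?leey//.
  by rewrite fin_num_measure.
rewrite inE; apply/andP; split; rewrite inE//=.
rewrite /finite_norm unlock /Lnorm; case: ifPn => _; last by rewrite ltry.
apply: (@le_lt_trans _ _ M%:E); last by rewrite ltry.
by apply/ess_sup_inf.ess_supP; apply: nearW => t /=; rewrite lee_fin.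
Qed.

(** * Algorithms on samples that begin with zeros *)

Section algorithm.
Context (R : realType) (A : iid_algorithm R).

Definition zero_seq : real_seq R := fun=> 0.

Lemma truncate0 n : truncate n zero_seq = zero_seq.
Proof. by apply/funext => j; rewrite /truncate; case: ifP. Qed.

(** For [i <= k.+1], whether the stopping value is at least [i] depends on the first [k] entries
    only. The answers at [k] and [k.+1] already force the value [Some k]. *)
Lemma stopping_zero_prefix u (y : real_seq R) k :
  @stopping _ A (u, zero_seq) = Some k ->
  (forall j, (j < k)%N -> y j = 0) ->
  stopping (u, y) = Some k /\ truncate (Some k) y = zero_seq.
Proof.
move=> s0 y0; split; last first.
  by apply/funext => j; rewrite /truncate/=; case: ifP => // /y0.
have sy i : (i <= k.+1)%N ->
    at_least (@stopping _ A (u, y)) i = (i <= k)%N.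
  move=> ik; rewrite (@stopping_nonanticipative _ A i u y zero_seq) ?s0//.
  by move=> j ji; rewrite y0//; rewrite -ltnS (leq_trans ji).
have := sy k (leqnSn k); have := sy k.+1 (leqnn _).
case: (stopping _) => [m|]; rewrite /= ?leqnn ?ltnn//.
move=> /negbT; rewrite -leqNgt => mk km; congr Some; apply/eqP.
by rewrite eqn_leq mk.
Qed.

(** This makes the success event measurable, so that its probability can be added to that of a
    disjoint event. *)
Lemma measurable_output d (Omega : measurableType d) (P : probability Omega R)
    (U : {RV P >-> aux A}) (X : nat -> {RV P >-> R}) :
  measurable_fun setT (output U X).
Proof.
have msample : measurable_fun setT (sample X).
  by apply: measurable_real_seq => i; exact: measurable_funP.
have mUX : measurable_fun setT (fun w => (U w, sample X w)).
  by apply: measurable_fun_pair; [exact: measurable_funP|exact: msample].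
apply: measurableT_comp; first exact: measurable_estimator.
apply: measurable_fun_pair; first exact: measurable_funP.
apply: measurable_real_seq => j; rewrite /truncate/=.
apply: measurable_fun_ifT => //.
apply: (measurable_fun_bool true) => //; rewrite setTI.
have := @measurable_stopping _ A [set n | at_least n j.+1].
by move=> /(measurable_preimage mUX).
Qed.

End algorithm.

(** Independence of [U] from the samples splits off the factor of [G]; independence of the samples
    leaves [N] factors, each at least [r]. *)
Lemma independent_zero_prefix d (Omega : measurableType d) (R : realType)
    (P : probability Omega R) (A : iid_algorithm R) (U : {RV P >-> aux A})
    (Y : {RV P >-> R}) (X : nat -> {RV P >-> R}) (G : set (aux A)) (N : nat)
    (r : R) :
  iid_input U Y X -> measurable G -> 0 <= r ->
  (r%:E <= P (Y @^-1` [set 0%R]))%E ->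
  (aux_law A G * (r ^+ N)%:E <=
   P (U @^-1` G `&` [set w | forall j, (j < N)%N -> X j w = 0%R]))%E.
Proof.
move=> [lawU [lawX indX] indUX] mG r0 rY.
pose C : set (real_seq R) := [set y | forall j, (j < N)%N -> y j = 0].
have mC : measurable C.
  have -> : C = \bigcap_(j in `I_N) [set y | [set 0] (y j)] by [].
  apply: bigcap_measurableType => j _; apply: sub_sigma_algebra.
  by exists j, [set 0].
rewrite -[X in P (_ `&` X)]/(sample X @^-1` C) indUX//.
rewrite -lawU// /distribution /pushforward; apply: lee_wpmul2l => //.
have -> : sample X @^-1` C =
    \bigcap_(i in [set` [fset i in iota 0 N]%fset]) X i @^-1` [set 0].
  apply/seteqP; split => w Cw j /=.
  - by rewrite inE/= mem_iota => jN; exact: Cw.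
  - by move=> jN; apply: Cw; rewrite /= inE/= mem_iota.
rewrite (indX _ (fun=> [set 0]))//.
rewrite (eq_bigr (fun=> P (Y @^-1` [set 0%R]))); last first.
  by move=> i _; rewrite -[LHS]/(distribution P (X i) [set 0%R]) lawX.
have sizeN : size [fset i in iota 0 N]%fset = N.
  rewrite -[RHS](size_iota 0 N); apply/perm_size/uniq_perm.
  - exact: fset_uniq.
  - exact: iota_uniq.
  - by move=> i; rewrite inE.
rewrite -[in leLHS]sizeN; elim: (enum_fset _) => [|i s IHs].
  by rewrite big_nil expr0.
by rewrite big_cons exprS EFinM lee_pmul// lee_fin exprn_ge0.
Qed.

(** On the zero input all randomness comes from [U]. Success has probability at least 3/4 and
    stopping is almost sure, so a large enough [N] keeps more than 1/2. *)
Lemma exists_likely_stopping (R : realType) (q : \bar R) (A : iid_algorithm R) :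
  (1 <= q)%E -> algorithm_on (Lq_class q) A ->
  (forall d (Omega : measurableType d) (P : probability Omega R)
     (U : {RV P >-> aux A}) (Y : {RV P >-> R}) (X : nat -> {RV P >-> R}),
     Lq_class q P Y -> iid_input U Y X ->
     ((1 - 4^-1)%:E <=
      P [set w | `|(output U X w)%:E - 'E_P[Y]| <= 1%:E])%E) ->
  exists N, let G := [set u | (exists2 k, (k <= N)%N &
      @stopping _ A (u, zero_seq R) = Some k) /\
      `|@estimator _ A (u, zero_seq R)| <= 1] in
    measurable G /\ (2^-1%:E < aux_law A G)%E.
Proof.
move=> q1 Aon Aok.
have p01 : 0 < (2^-1 : R) < 1 by lra.
(* A coin with values 0 and K = 0 realizes the constant random variable 0. *)
have [d [T [P [U [Y [X [S [iid mS _ YE X0]]]]]]]] := coin_realization A 0 p01.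
have {YE} Y0 : (Y : T -> R) = cst 0.
  by rewrite YE; apply/funext => w /=; rewrite mulr0.
have {X0} X0 w : sample X w = zero_seq R.
  by apply/funext => i; case: (X0 i w).
have YC : Lq_class q P Y.
  by rewrite Y0; apply: (@Lfun_bounded _ _ _ _ _ _ 0) => // t; rewrite normr0.
have ae_fin := Aon _ _ _ _ _ _ YC iid.
have [lawU _ _] := iid.
have mz : measurable_fun setT (fun u : aux A => (u, zero_seq R)).
  by apply: measurable_fun_pair; [exact: measurable_id|exact: measurable_cst].
pose F := [set u | `|@estimator _ A (u, zero_seq R)| <= 1].
pose D (Q : set (option nat)) := [set u | Q (@stopping _ A (u, zero_seq R))].
have mD Q : measurable (D Q).
  exact: measurable_preimage mz (@measurable_stopping _ A Q).
have mF : measurable F.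
  have mE : measurable_fun setT
      (fun u : aux A => `|@estimator _ A (u, zero_seq R)|).
    apply: measurableT_comp => //.
    exact: measurableT_comp (@measurable_estimator _ A) mz.
  rewrite [F](_ : _ = (fun u : aux A => `|@estimator _ A (u, zero_seq R)|)
    @^-1` `]-oo, 1]).
    exact: measurable_preimage mE (measurable_itv _).
  by apply/seteqP; split => u; rewrite /F/= in_itv.
(* With zero samples and mean 0, the success event is exactly that [U] falls in [F]. *)
have F34 : ((1 - 4^-1)%:E <= aux_law A F)%E.
  rewrite -lawU// (le_trans (Aok _ _ _ _ _ _ YC iid))// Y0 expectation_cst.
  rewrite le_eqVlt; apply/orP; left; apply/eqP; congr (P _).
  apply/seteqP; split => w;
    by rewrite /F /= /output X0 truncate0 subr0 lee_fin.
have D1 : aux_law A (D [set None]) = 0%E.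
  rewrite -lawU//.
  move: ae_fin => [Z [mZ PZ subZ]].
  apply: (subset_measure0 _ mZ _ PZ).
    exact: measurable_preimage (measurable_funP U) _.
  move=> w DUw; apply: subZ => /=.
  by rewrite /sample_size X0 => /(_ DUw).
pose G N := D [set n | exists2 k, (k <= N)%N & n = Some k] `&` F.
have mG N : measurable (G N) by exact: measurableI.
have : (2^-1%:E < aux_law A (\bigcup_N G N))%E.
  apply: (@lt_le_trans _ _ (1 - 4^-1)%:E); first by rewrite lte_fin; lra.
  rewrite (le_trans F34)// -[leRHS]adde0 -D1.
  have mbG : measurable (\bigcup_N G N) by exact: bigcupT_measurable.
  apply: (le_trans _ (measureU2 _ _ _)) => //.
  apply: le_measure; rewrite ?inE//; first exact: measurableU.
  move=> u Fu; rewrite /D /=.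
  case sE : (@stopping _ A (u, zero_seq R)) => [k|]; last by right.
  by left; exists k => //; split => //; exists k.
(* The sets [G N] increase and exhaust [F] up to the null set of non-termination. Were all their
   masses at most 1/2, so would be the limit. *)
have cvgG : (aux_law A \o G) N @[N --> \oo] --> aux_law A (\bigcup_N G N).
  apply: nondecreasing_cvg_mu => //; first exact: bigcupT_measurable.
  move=> m n mn; apply/subsetPset => u [[k km sE] Fu]; split => //.
  by exists k => //; exact: leq_trans mn.
rewrite -(cvg_lim _ cvgG)//; apply: contraPP => /forallNP noN; apply/negP.
rewrite -leNgt; apply: lime_le; first by apply/cvg_ex; eexists; exact: cvgG.
apply: nearW => N /=; rewrite leNgt; apply/negP => GN; apply: (noN N).
by split => //; exact: mG.
Qed.

(** * Contradiction from a rare large value *)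

Lemma bernoulli_inequality (R : realDomainType) (x : R) n :
  0 <= x <= 1 -> 1 - n%:R * x <= (1 - x) ^+ n.
Proof.
move=> x01; elim: n => [|n IHn]; first by rewrite expr0; lra.
have := ler0n R n; rewrite exprS -natr1; nra.
Qed.

Theorem theorem3p4 (R : realType) (q : \bar R) (hq : (1 <= q)%E) :
  ~ solvable (Lq_class q).
Proof.
move=> solv.
have delta01 : 0 < (4^-1 : R) < 1 by lra.
have [A [Aon Aok]] := solv 1 4^-1 ltr01 delta01.
have [N /=] := exists_likely_stopping hq Aon Aok.
set G := [set u | _] => -[mG GN].
(* Chosen so that [N * p <= 1/4]; [N.+1] instead of [N] avoids division by zero and keeps [p <= 1/4]
   when [N = 0]. *)
pose p : R := (4 * N.+1%:R)^-1.
have N1 : (1 : R) <= N.+1%:R by rewrite ler1n.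
have p0 : 0 < p by rewrite invr_gt0; lra.
have Np : N%:R * p <= 4^-1.
  rewrite /p invfM mulrCA -[leRHS]mulr1 ler_wpM2l//.
  by rewrite ler_pdivrMr ?mul1r ?ler_nat//; lra.
have p14 : p <= 4^-1.
  by rewrite /p invfM ler_piMr// invf_le1//; lra.
have p01 : 0 < p < 1 by lra.
(* The value [3 / p] makes the mean 3, so that the outputs with error at most 1 fill [2, 4], away
   from [-1, 1]. *)
have [d [T [P [U [Y [X [S [iid mS PS YE _]]]]]]]] :=
  coin_realization A (3 / p) p01.
have YC : Lq_class q P Y.
  apply: (@Lfun_bounded _ _ _ _ _ _ `|3 / p|) => // t.
  by rewrite YE /= indicE; case: (_ \in _); rewrite ?mul1r ?mul0r ?normr0.
have EY : ('E_P[Y] = 3%:E)%E.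
  have indL : (\1_S : T -> R) \in Lfun P 1.
    apply: (@Lfun_bounded _ _ _ _ _ _ 1) => // t.
    by rewrite indicE; case: (_ \in _); rewrite ?normr1 ?normr0.
  by rewrite YE expectationZl// expectation_indic// PS -EFinM divfK ?gt_eqF.
have PY0 : ((1 - p)%:E <= P (Y @^-1` [set 0%R]))%E.
  rewrite EFinB -PS -probability_setC//; apply: le_measure; rewrite ?inE.
  - exact: measurableC.
  - exact: measurable_preimage (measurable_funP Y) _.
  - by move=> t /= nSt; rewrite YE /= indicE memNset ?mul0r.
have pN : 3 / 4 <= (1 - p) ^+ N.
  have p01' : 0 <= p <= 1 by lra.
  by have := bernoulli_inequality N p01'; lra.
set Z := [set w | forall j, (j < N)%N -> X j w = 0%R].
pose V := U @^-1` G `&` Z.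
have PV : ((3 / 8)%:E <= P V)%E.
  have p1 : 0 <= 1 - p by lra.
  apply: le_trans (independent_zero_prefix N iid mG p1 PY0).
  have -> : 3 / 8 = 2^-1 * (3 / 4) :> R by lra.
  by rewrite EFinM lee_pmul// ?ltW// lee_fin; lra.
pose W := [set w | (`|(output U X w)%:E - 'E_P[Y]| <= 1%:E)%E].
have PW : ((1 - 4^-1)%:E <= P W)%E by exact: Aok YC iid.
have mV : measurable V.
  apply: measurableI; first exact: measurable_preimage (measurable_funP U) _.
  have -> : Z = \bigcap_(j in `I_N) X j @^-1` [set 0%R] by [].
  apply: bigcap_measurableType => j _.
  exact: measurable_preimage (measurable_funP (X j)) _.
have mW : measurable W.
  rewrite [W](_ : _ = output U X @^-1` `[2, 4]).
    exact: measurable_preimage (measurable_output U X) _.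
  apply/seteqP; split => w; rewrite /W/= EY lee_fin in_itv/= ler_norml;
    by move=> /andP[? ?]; lra.
(* On [V] the output is the one computed from the zero sequence, of modulus at most 1; on [W] it is
   at least 2. *)
have VW : V `&` W = set0.
  rewrite -subset0 => w [[[[k kN sE] est] Zw]]; rewrite /W/= EY lee_fin.
  have [] := @stopping_zero_prefix _ A (U w) (sample X w) k sE.
    by move=> j jk; apply: Zw; exact: leq_trans kN.
  rewrite /output /sample_size => -> ->.
  move: est; rewrite !ler_norml => /andP[? ?] /andP[? ?].
  suff : (1 : R) <= 0 by rewrite ler10.
  by lra.
(* The lower bounds 3/8 and 3/4 add up to 9/8, too much for disjoint events. *)
have : (P V + P W <= 1)%E.
  by rewrite -measureU// probability_le1//; exact: measurableU.
apply/negP; rewrite -ltNge.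
apply: lt_le_trans (leeD PV PW).
by rewrite -EFinD lte_fin; lra.
Qed.
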